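(* Let $q$ be an even prime power and let $n$ be a positive integer with $(n-1)\mid(q-1)$. Put $U=\{a\in\mathbb{F}_q:a^n=a\}$ and $S_k=\{\sum_{\alpha\in J}\alpha:\ J\subset U,\ \sharp J=k\}$. Then, for any integer $k\le\lfloor n/2\rfloor$ and any $0\le r\le k-1$: 1) there exists an MDS $[n,k,n-k+1]_q$ code $C$ with $0\le\dim \mathrm{Hull}_E(C)\le k-r$ if there exists $\eta\in\mathbb{F}_q^*$ such that $\eta^{-1}\ne-a$ for all $a\in S_k$; 2) there exists an AMDS $[n,k,n-k]_q$ code $C$ with $0\le\dim \mathrm{Hull}_E(C)\le k-r$ if there exists $\eta\in\mathbb{F}_q^*$ such that $\eta^{-1}=-a$ for some $a\in S_k$.
   Context: An $[n,k,d]_q$ code is a linear code over $\mathbb{F}_q$ of length $n$, dimension $k$ and minimum Hamming distance $d$; it is MDS if $d=n-k+1$ and AMDS (almost MDS) if $d=n-k$. The Euclidean inner product on $\mathbb{F}_q^n$ is $\langle x,y\rangle_E=\sum_i x_iy_i$, $C^{\perp_E}$ is the dual of $C$ with respect to it, and $\mathrm{Hull}_E(C)=C\cap C^{\perp_E}$. *)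

(* Defs.v *)
From HB Require Import structures.
From mathcomp Require Import all_boot all_order all_algebra.

Set Implicit Arguments.
Unset Strict Implicit.
Unset Printing Implicit Defensive.

Import GRing.Theory.
Local Open Scope ring_scope.

Section EuclideanForm.
Variables (F : fieldType) (n : nat).

Definition edot (x y : 'rV[F]_n) : F := \sum_(i < n) x 0 i * y 0 i.

Fact edot_bilinear : bilinear_for
  (GRing.Scale.Law.clone _ _ *%R _) (GRing.Scale.Law.clone _ _ *%R _) edot.
Proof.
split=> [y a x x' | x a y y']; rewrite /edot /= mulr_sumr -big_split /=;
  apply: eq_bigr => i _; rewrite !mxE.
  by rewrite mulrDl mulrA.
by rewrite mulrDr mulrCA.
Qed.

HB.instance Definition _ := bilinear_isBilinear.Build F 'rV[F]_n 'rV[F]_n F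
  (GRing.Scale.Law.clone _ _ *%R _) (GRing.Scale.Law.clone _ _ *%R _)
  edot edot_bilinear.

Fact edot_hermitian (x y : 'rV[F]_n) :
  edot x y = (-1) ^+ false * idfun (edot y x).
Proof.
by rewrite expr0 mul1r; apply: eq_bigr => i _; rewrite mulrC.
Qed.

HB.instance Definition _ :=
  isHermitianSesquilinear.Build F 'rV[F]_n false idfun edot edot_hermitian.

Definition euclid_dual (C : {vspace 'rV[F]_n}) : {vspace 'rV[F]_n} :=
  orthov (edot : {symmetric 'rV[F]_n}) C.

Lemma mem_euclid_dualP (C : {vspace 'rV[F]_n}) (x : 'rV[F]_n) :
  reflect {in C, forall y, edot x y = 0} (x \in euclid_dual C).
Proof. exact: (@mem_orthovP F false _ _ (edot : {symmetric 'rV[F]_n}) C x). Qed.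

Definition euclid_hull (C : {vspace 'rV[F]_n}) : {vspace 'rV[F]_n} :=
  (C :&: euclid_dual C)%VS.

End EuclideanForm.

Section Codes.
Variables (F : fieldType) (n : nat).

Definition hamming_dist (x y : 'rV[F]_n) : nat := #|[set i | x 0 i != y 0 i]|.

(* A predicate rather than a function: the zero code has no minimum distance. *)
Definition min_distance (C : {vspace 'rV[F]_n}) (d : nat) : Prop :=
  (exists x y, [/\ x \in C, y \in C, x != y & hamming_dist x y = d]) /\
  (forall x y, x \in C -> y \in C -> x != y -> (d <= hamming_dist x y)%N).

Definition is_code (k d : nat) (C : {vspace 'rV[F]_n}) : Prop :=
  \dim C = k /\ min_distance C d.

(* The truncated subtractions are exact, since \dim C <= n. *)
Definition MDS (C : {vspace 'rV[F]_n}) : Prop :=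
  min_distance C (n - \dim C + 1).

Definition AMDS (C : {vspace 'rV[F]_n}) : Prop :=
  min_distance C (n - \dim C).

End Codes.

Section SubsetSums.
Variables (F : finFieldType) (n : nat).

Definition Uset : {set F} := [set a : F | a ^+ n == a].

Definition Ssums (k : nat) : {set F} :=
  [set \sum_(x in J) x | J : {set F} & (J \subset Uset) && (#|J| == k)].

End SubsetSums.

(* Main.v *)
Require Import Defs.
From mathcomp Require Import all_boot all_order all_algebra all_field.

(* C is a twisted Reed-Solomon code: it evaluates at the n points of U the
   polynomials f of degree at most k with f_k = eta f_(k-1), and scales the
   i-th coordinate by some nonzero v_i. A nonzero f has k roots in U only if it
   is a multiple of \prod_(x in J) ('X - x) with J a k-subset of U; comparing
   the coefficients k - 1 and k, this occurs exactly when
   eta^-1 = - \sum_(x in J) x, hence the MDS/AMDS dichotomy.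
   Given a generator matrix G, the hull is zero as soon as G diag(v^2) G^T is
   invertible, and every d in F^n is of the form v^2 since q is even. Starting
   with the indicator vector d of an information set, each zero entry of d can
   be made nonzero by a rank one update, which destroys invertibility for at
   most one value of the new entry, and F has two nonzero elements once q > 2. *)

Set Implicit Arguments.
Unset Strict Implicit.
Unset Printing Implicit Defensive.

Import GRing.Theory.
Local Open Scope ring_scope.

(** * Counting the evaluation points *)

(** As [n - 1] divides [q - 1], the polynomial ['X^n - 'X] divides ['X^q - 'X], the product of all
    ['X - a]; hence it splits into [n] distinct linear factors. *)
Lemma card_Uset (F : finFieldType) (n : nat) :
  (1 < n)%N -> (n - 1 %| #|F| - 1)%N -> #|Uset F n| = n.
Proof.
case: n => [|[|n]] // _; rewrite subn1 /= => /dvdnP[c cE].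
pose p : {poly F} := 'X^(n.+2) - 'X.
have size_p : size p = n.+3.
  by rewrite size_polyDl size_polyXn // size_polyN size_polyX.
have rootp x : root p x = (x ^+ n.+2 == x).
  by rewrite rootE !hornerE subr_eq0.
have p_dvd : p %| \prod_(x <- index_enum F) ('X - x%:P).
  rewrite -finField_genPoly.
  have -> : #|F| = (#|F| - 1).+1.
    by rewrite subn1 prednK //; apply/card_gt0P; exists 0.
  have -> : 'X^((#|F| - 1).+1) - 'X = 'X * ('X^(n.+1) ^+ c - 1) :> {poly F}.
    by rewrite cE mulnC exprS exprM mulrBr mulr1.
  by rewrite subrX1 mulrA mulrBr mulr1 -exprS dvdp_mulIl.
have [m Em] := dvdp_prod_XsubC p_dvd.
set rs := mask m (index_enum F) in Em.
have uniq_rs : uniq rs by rewrite mask_uniq // index_enum_uniq.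
have UE : Uset F n.+2 =i rs.
  by move=> x; rewrite inE -rootp (eqp_root Em) root_prod_XsubC.
move: (eqp_size Em); rewrite size_p size_prod_XsubC => -[sizeE].
by rewrite (eq_card UE) (card_uniqP uniq_rs) sizeE.
Qed.

(** * Symmetric matrices [G diag(d) G^T] and their invertibility *)

Section DiagonalForms.
Variables (F : fieldType) (k n : nat).

(** A vector [w] killed by the update is a multiple of [y M^-1], with factor [- t s] where
    [s = w x]. Multiplying by [x] gives [s (1 + t c) = 0], so [s], and with it [w], vanishes. *)
Lemma unitmx_rank1_update (M : 'M[F]_k) (x : 'cV_k) (y : 'rV_k) (t : F) :
  M \in unitmx -> 1 + t * (y *m invmx M *m x) 0 0 != 0 ->
  M + t *: (x *m y) \in unitmx.
Proof.
move=> uM; set c := (_ *m x) 0 0 => c0.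
rewrite -row_free_unit; apply: inj_row_free => w.
rewrite mulmxDr -scalemxAr mulmxA [w *m x]mx11_scalar mul_scalar_mx scalerA.
set s := (w *m x) 0 0 => /eqP; rewrite addr_eq0 => /eqP wM.
have wE : w = - ((t * s) *: (y *m invmx M)).
  by rewrite scalemxAl -mulNmx -wM mulmxK.
have sE : s * (1 + t * c) = 0.
  have : s = - (t * s * c) by rewrite {1}/s wE mulNmx -scalemxAl mxE [X in - X]mxE.
  by move=> sN; rewrite mulrDr mulr1 {1}sN mulrCA mulrA addNr.
have /eqP s0 : s == 0 by move/eqP: sE; rewrite mulf_eq0 (negPf c0) orbF.
by rewrite wE s0 mulr0 scale0r oppr0.
Qed.

Lemma mulmx_diagD_tr (G : 'M[F]_(k, n)) (d : 'rV_n) (i : 'I_n) (t : F) :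
  G *m diag_mx (d + t *: delta_mx 0 i) *m G^T =
  G *m diag_mx d *m G^T + t *: (col i G *m (col i G)^T).
Proof.
rewrite linearD linearZ /= mulmxDr mulmxDl -scalemxAr -scalemxAl.
congr (_ + _ *: _).
have -> : diag_mx (delta_mx 0 i) = delta_mx i 0 *m delta_mx (0 : 'I_1) i :> 'M[F]_n.
  rewrite mul_delta_mx; apply/matrixP=> a b; rewrite !mxE eqxx /=.
  have [->|ab] := eqVneq a b; first by rewrite andbb.
  by rewrite mulr0n; case: (a =P i) ab => // ->; rewrite eq_sym => /negPf->.
by rewrite mulmxA -colE -mulmxA -rowE tr_col.
Qed.

Lemma info_set_scaling (G : 'M[F]_(k, n)) : row_free G ->
  exists d : 'rV_n, G *m diag_mx d *m G^T \in unitmx.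
Proof.
move=> fG; have GT : row_full G^T by rewrite /row_full mxrank_tr.
(* [f] selects [k] independent columns of [G], an information set; with [d] its indicator, the
   product is [B B^T] for the invertible square block [B] of these columns. *)
pose f := fullrankfun GT.
exists (\row_i (i \in codom f)%:R).
have <- : (rowsub f G^T)^T *m rowsub f G^T =
    G *m diag_mx (\row_i (i \in codom f)%:R) *m G^T.
  apply/matrixP=> a b; rewrite mul_mx_diag !mxE.
  pose E i := G a i * G b i.
  transitivity (\sum_(i in codom f) E i).
    rewrite -big_uniq /=; last exact/injectiveP/fullrankfun_inj.
    by rewrite big_image; apply: eq_bigr => j _; rewrite !mxE.
  rewrite big_mkcond; apply: eq_bigr => i _; rewrite !mxE /E.
  by case: ifP; rewrite ?mulr1 // mulr0 mul0r.
by rewrite unitmx_mul unitmx_tr fullrowsub_unit.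
Qed.

End DiagonalForms.

Lemma nondegenerate_scaling (F : finFieldType) (k n : nat) (G : 'M[F]_(k, n)) :
  (2 < #|F|)%N -> row_free G ->
  exists2 d : 'rV_n, forall i, d 0 i != 0
                   & G *m diag_mx d *m G^T \in unitmx.
Proof.
move=> F2 /info_set_scaling[d].
have [N] := ubnP #|[set i | d 0 i == 0]|; elim: N => // N IHN in d *.
rewrite ltnS => leN ud.
have [/existsP[i /eqP di]|] := boolP [exists i, d 0 i == 0]; last first.
  by rewrite negb_exists => /forallP dn0; exists d => // i; apply: dn0.
set M := _ *m _ *m _ in ud.
pose c := ((col i G)^T *m invmx M *m col i G) 0 0.
(* The value [- c^-1] is the only one with [1 + t c = 0]. If [c = 0], the convention [0^-1 = 0]
   makes both conditions on [t] coincide, and [1 + t c] is 1. *)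
have [t /andP[t0 tc]] : exists t : F, (t != 0) && (t != - c^-1).
  have : (0 < #|~: [set 0%R; (- c^-1)%R]|)%N.
    rewrite cardsCs setCK subn_gt0 cards2 (leq_ltn_trans _ F2) //.
    by case: (_ != _).
  by case/card_gt0P=> t; rewrite !inE negb_or; exists t.
apply: (IHN (d + t *: delta_mx 0 i)).
  apply: leq_trans leN; apply/proper_card/properP; split.
    apply/subsetP=> j; rewrite !inE !mxE eqxx /=.
    have [->|_] := eqVneq j i; last by rewrite mulr0 addr0.
    by rewrite di eqxx.
  exists i; rewrite inE ?di // !mxE di !eqxx add0r mulr1 //.
rewrite mulmx_diagD_tr; apply: unitmx_rank1_update => //.
apply: contra tc; rewrite addrC addr_eq0 -/M -/c => /eqP tcE.
have c0 : c != 0.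
  apply/eqP=> c0; move/eqP: tcE.
  by rewrite c0 mulr0 eq_sym oppr_eq0 oner_eq0.
by rewrite -[t](mulfK c0) tcE mulN1r.
Qed.

(** Squaring [d^(q/2)] gives [d^q], which is [d]. *)
Lemma sqrt_even_card (F : finFieldType) (d : F) :
  ~~ odd #|F| -> exists v, v ^+ 2 = d.
Proof.
move=> evF; exists (d ^+ #|F|./2).
by rewrite -exprM muln2 even_halfK // expf_card.
Qed.

(** * Codes given by a generator matrix: weights, hull, Singleton bound *)

Section GeneratorMatrix.
Variables (F : fieldType) (k n : nat).
Implicit Types (A G : 'M[F]_(k, n)) (x : 'rV[F]_n).

Definition gen_code A : {vspace 'rV[F]_n} := limg (linfun (mulmxr A)).

Definition weight x := #|[set i | x 0 i != 0]|.

Lemma gen_codeP A x : reflect (exists m : 'rV_k, x = m *m A) (x \in gen_code A).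
Proof.
apply: (iffP memv_imgP) => [[m _ ->]|[m ->]]; exists m; rewrite ?memvf //.
  by rewrite lfunE.
by rewrite lfunE.
Qed.

Lemma dim_gen_code A : row_free A -> \dim (gen_code A) = k.
Proof.
move=> fA; rewrite limg_dim_eq; first by rewrite dimvf dim_matrix mul1r.
apply/eqP; rewrite capfv; apply/lker0P=> m1 m2; rewrite !lfunE /=; exact: row_free_inj.
Qed.

Lemma edotE x y : edot x y = (x *m y^T) 0 0.
Proof. by rewrite mxE; apply: eq_bigr => i _; rewrite !mxE. Qed.

(** A word [m A] of the hull is orthogonal to every row of [A], so [m A A^T = 0] and [m = 0]. *)
Lemma hull_gen_code0 A :
  A *m A^T \in unitmx -> euclid_hull (gen_code A) = 0%VS.
Proof.
move=> uA; apply/eqP; rewrite -subv0; apply/subvP=> x.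
rewrite memv_cap memv0 => /andP[/gen_codeP[m ->] /mem_euclid_dualP mA0].
suff mAA0 : m *m (A *m A^T) = 0.
  by rewrite -(mulmxK uA m) mAA0 !mul0mx.
apply/rowP=> j; rewrite [RHS]mxE.
have := mA0 (delta_mx 0 j *m A); rewrite edotE trmx_mul trmx_delta.
rewrite -!mulmxA [A *m (_ *m _)]mulmxA [m *m _]mulmxA -colE mxE => -> //.
by apply/gen_codeP; exists (delta_mx 0 j).
Qed.

Lemma min_distance_weight (C : {vspace 'rV[F]_n}) (d : nat) :
  (exists x, [/\ x \in C, x != 0 & weight x = d]) ->
  (forall x, x \in C -> x != 0 -> (d <= weight x)%N) -> min_distance C d.
Proof.
have distE (x y : 'rV[F]_n) : hamming_dist x y = weight (x - y).
  by apply: eq_card => i; rewrite !inE !mxE subr_eq0.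
move=> [x [Cx x0 wx]] dC; split.
  by exists x, 0; rewrite mem0v distE subr0.
by move=> {Cx x0 wx}x y Cx Cy xy; rewrite distE dC ?memvB ?subr_eq0.
Qed.

Lemma weight_diag x (v : 'rV[F]_n) :
  (forall i, v 0 i != 0) -> weight (x *m diag_mx v) = weight x.
Proof.
move=> v0; apply: eq_card => i; rewrite !inE mul_mx_diag !mxE.
by rewrite mulf_eq0 (negPf (v0 i)) orbF.
Qed.

Lemma weight0 : weight 0 = 0%N.
Proof.
by apply/eqP; rewrite cards_eq0; apply/eqP/setP => i; rewrite !inE mxE eqxx.
Qed.

Lemma weight_row_free A :
  (forall m, m != 0 -> (0 < weight (m *m A))%N) -> row_free A.
Proof.
move=> wA; apply: inj_row_free => m mA0; apply: contraTeq isT => /wA.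
by rewrite mA0 weight0.
Qed.

(** Scaling by nonzero [v] preserves weights, so they can be studied on [G] alone. Positivity of [d]
    makes the encoding injective, which settles the dimension. *)
Lemma is_code_gen_diag G (v : 'rV[F]_n) (d : nat) :
  (forall i, v 0 i != 0) -> (0 < d)%N ->
  (forall m, m != 0 -> (d <= weight (m *m G))%N) ->
  (exists2 m, m != 0 & weight (m *m G) = d) ->
  is_code k d (gen_code (G *m diag_mx v)).
Proof.
move=> v0 d0 dG [m m0 wm].
have fA : row_free (G *m diag_mx v).
  by apply: weight_row_free => w /dG wd; rewrite mulmxA weight_diag // (leq_trans d0).
split; first exact: dim_gen_code.
apply: min_distance_weight.
  exists (m *m (G *m diag_mx v)); split; first by apply/gen_codeP; exists m.
    by apply: contraTneq d0; rewrite mulmxA -wm -(weight_diag _ v0) => ->; rewrite weight0.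
  by rewrite mulmxA weight_diag.
move=> x /gen_codeP[w ->] wA0; rewrite mulmxA weight_diag //; apply: dG.
by apply: contraNneq wA0 => ->; rewrite mul0mx.
Qed.

End GeneratorMatrix.

Lemma singleton_bound (F : fieldType) (k n : nat) (G : 'M[F]_(k.+1, n)) :
  (k <= n)%N -> exists2 m : 'rV_k.+1, m != 0 & (weight (m *m G) <= n - k)%N.
Proof.
move=> kn; pose g := widen_ord kn.
(* Vanishing on the first [k] coordinates imposes [k] linear conditions on [k.+1] unknowns. *)
have : kermx (colsub g G) != 0.
  by rewrite kermx_eq0 -row_leq_rank -ltnNge ltnS rank_leq_col.
case/rowV0Pn=> m /sub_kermxP mG m0; exists m => //.
rewrite /weight cardsCs card_ord leq_sub2l //.
rewrite -{1}(card_ord k) -(card_imset (f := g)); last first.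
  by move=> i j /(congr1 val) /= /val_inj.
apply/subset_leq_card/subsetP=> _ /imsetP[j _ ->]; rewrite !inE negbK.
by move/rowP/(_ j): mG; rewrite mulmx_colsub !mxE => ->.
Qed.

Lemma coefn_prod_XsubC (R : comNzRingType) (s : seq R) :
  (\prod_(a <- s) ('X - a%:P))`_(size s) = 1.
Proof.
have /monicP := monic_prod_XsubC s xpredT id.
by rewrite lead_coefE size_prod_XsubC.
Qed.

(** * Zeros of twisted polynomials and weights of the twisted code *)

Section TwistedReedSolomon.
Variables (F : finFieldType) (n k : nat) (eta : F) (u : 'I_n -> F).
Hypothesis u_inj : injective u.
Implicit Types (m : 'rV[F]_k.+1) (J : {set F}).

(** The dimension is [k.+1] here, so the twist ties the coefficient of degree [k.+1] to that of
    degree [k]. *)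
Definition twpoly m : {poly F} := rVpoly m + (eta * m 0 ord_max) *: 'X^(k.+1).

Definition trs_mx : 'M[F]_(k.+1, n) :=
  \matrix_(j, i) (u i ^+ j + eta *+ (j == ord_max) * u i ^+ k.+1).

Definition zeros m : {set 'I_n} := [set i | root (twpoly m) (u i)].

Lemma horner_twpoly m i : (m *m trs_mx) 0 i = (twpoly m).[u i].
Proof.
rewrite mxE !hornerE horner_poly.
under eq_bigr do rewrite mxE mulrDr.
rewrite big_split /=; congr (_ + _).
  by apply: eq_bigr => j _; rewrite valK.
rewrite (bigD1 ord_max) //= eqxx big1 ?addr0 => [|j /negPf->].
  by rewrite mulr1n mulrA [m _ _ * eta]mulrC.
by rewrite mulr0n mul0r mulr0.
Qed.

Lemma coef_twpoly m (j : 'I_k.+1) : (twpoly m)`_j = m 0 j.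
Proof.
rewrite coefD coefZ coefXn coef_rVpoly_ord [val j == _]ltn_eqF //= mulr0.
by rewrite addr0.
Qed.

Lemma coefS_twpoly m : (twpoly m)`_k.+1 = eta * (twpoly m)`_k.
Proof.
rewrite (coef_twpoly m ord_max) coefD coefZ coefXn eqxx mulr1 nth_default ?add0r //.
exact: size_poly.
Qed.

Lemma size_twpoly m : (size (twpoly m) <= k.+2)%N.
Proof.
apply: leq_trans (size_polyD _ _) _; rewrite geq_max.
rewrite (leq_trans (size_poly _ _)) // (leq_trans (size_scale_leq _ _)) //.
by rewrite size_polyXn.
Qed.

Lemma twpoly_eq0 m : (twpoly m == 0) = (m == 0).
Proof.
apply/eqP/eqP=> [p0|->]; last by rewrite /twpoly linear0 mxE mulr0 scale0r addr0.
by apply/rowP=> j; rewrite -coef_twpoly p0 coef0 mxE.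
Qed.

(** The message is read off the coefficients of degree at most [k]; the relation forces the last
    one. *)
Lemma twpoly_surj (p : {poly F}) :
  (size p <= k.+2)%N -> p`_k.+1 = eta * p`_k -> exists m, twpoly m = p.
Proof.
move=> sp pk; exists (\row_j p`_j); apply/polyP=> i.
have [ik|] := ltnP i k.+1; first by rewrite (coef_twpoly _ (Ordinal ik)) mxE.
rewrite leq_eqVlt => /predU1P[<-|ki].
  by rewrite coefS_twpoly (coef_twpoly _ ord_max) mxE.
by rewrite !nth_default // (leq_trans _ ki) ?size_twpoly.
Qed.

Lemma weight_trs m : weight (m *m trs_mx) = (n - #|zeros m|)%N.
Proof.
rewrite /weight cardsCs card_ord; congr (_ - _)%N; apply: eq_card => i.
by rewrite !inE horner_twpoly negbK.
Qed.

Lemma card_zeros m : m != 0 -> (#|zeros m| <= k.+1)%N.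
Proof.
rewrite -twpoly_eq0 => p0; rewrite -(card_imset _ u_inj) cardE -ltnS.
apply: leq_trans (size_twpoly m); apply: max_poly_roots (enum_uniq _) => //.
by apply/allP=> x; rewrite mem_enum => /imsetP[i]; rewrite inE => ? ->.
Qed.

(* Such a polynomial is a multiple of \prod_(x in J) ('X - x), whose two
   leading coefficients are 1 and - \sum_(x in J) x. *)
Lemma zeros_max_sum m : m != 0 -> #|zeros m| = k.+1 ->
  eta^-1 = - \sum_(x in u @: zeros m) x.
Proof.
rewrite -twpoly_eq0 => p0 cZ; set J := u @: _.
have sJ : size (enum J) = k.+1 by rewrite -cardE card_imset.
have Jroot : all (root (twpoly m)) (enum J).
  by apply/allP=> x; rewrite mem_enum => /imsetP[i]; rewrite inE => ? ->.
have sp : size (twpoly m) = (size (enum J)).+1.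
  apply/eqP; rewrite eqn_leq (max_poly_roots p0 Jroot) ?enum_uniq // andbT.
  by rewrite sJ size_twpoly.
have := all_roots_prod_XsubC sp Jroot.
rewrite uniq_rootsE enum_uniq => /(_ isT) pE.
have := coefS_twpoly m; rewrite pE !coefZ -sJ coefn_prod_XsubC.
have -> : k = (size (enum J)).-1 by rewrite sJ.
rewrite coefPn_prod_XsubC ?sJ // big_enum mulr1 mulrCA -{1}[lead_coef _]mulr1.
move/(mulfI _) => /=; rewrite lead_coef_eq0 => /(_ p0) E.
(* [E] equates 1 with a multiple of [eta], so [eta] is nonzero and can be inverted. *)
by rewrite -[LHS]mulr1 E mulKf //; apply: contra_eq_neq E => ->; rewrite mul0r oner_neq0.
Qed.

(** Converse to [zeros_max_sum]: the condition on [eta] is exactly the twist relation for a multiple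
    of the product over [J]. *)
Lemma zeros_of_sum J : J \subset u @: setT -> #|J| = k.+1 -> eta != 0 ->
  eta^-1 = - \sum_(x in J) x -> exists2 m, m != 0 & #|zeros m| = k.+1.
Proof.
move=> JU cJ eta0 etaE.
(* The factor [eta] normalises the coefficient of degree [k] to 1. *)
pose p := eta *: \prod_(x <- enum J) ('X - x%:P).
have sJ : size (enum J) = k.+1 by rewrite -cardE.
have pk : p`_k.+1 = eta * p`_k.
  rewrite !coefZ -sJ coefn_prod_XsubC.
  have -> : k = (size (enum J)).-1 by rewrite sJ.
  by rewrite coefPn_prod_XsubC ?sJ // big_enum -etaE mulfV.
have sp : size p = k.+2 by rewrite size_scale // size_prod_XsubC sJ.
have [|m mp] := twpoly_surj _ pk; first by rewrite sp.
have m0 : m != 0 by rewrite -twpoly_eq0 mp -size_poly_eq0 sp.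
exists m => //; apply/eqP; rewrite eqn_leq card_zeros //= -cJ.
rewrite -(card_imset _ u_inj); apply/subset_leq_card/subsetP=> x Jx.
have /imsetP[i _ xE] := subsetP JU _ Jx; apply/imsetP; exists i => //.
by rewrite inE mp rootZ // root_prod_XsubC mem_enum -xE.
Qed.

End TwistedReedSolomon.

(* Over F_2 the hypotheses force n = 2 and k = 1, so the bound on the hull is
   trivial; over a larger field the hull can be made zero. *)
Lemma hull_scaling (F : finFieldType) (n k r : nat) (G : 'M[F]_(k, n)) :
  ~~ odd #|F| -> (n - 1 %| #|F| - 1)%N -> (k <= n %/ 2)%N -> (r < k)%N ->
  row_free G ->
  exists2 v : 'rV_n, forall i, v 0 i != 0
    & (\dim (euclid_hull (gen_code (G *m diag_mx v))) <= k - r)%N.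
Proof.
move=> evF nq kn rk fG.
have [F2|F2] := ltnP 2 #|F|.
  have [d d0 ud] := nondegenerate_scaling F2 fG.
  have [v vd] : exists v : 'rV_n, forall i, v 0 i ^+ 2 = d 0 i.
    have sq i : exists y, y ^+ 2 == d 0 i.
      by have [y <-] := sqrt_even_card (d 0 i) evF; exists y.
    by exists (\row_i xchoose (sq i)) => i; rewrite mxE (eqP (xchooseP (sq i))).
  exists v => [i|].
    by apply: contraNneq (d0 i) => vi0; rewrite -vd vi0 expr0n.
  rewrite hull_gen_code0 ?dimv0 // trmx_mul tr_diag_mx mulmxA -(mulmxA G).
  suff -> : diag_mx v *m diag_mx v = diag_mx d by [].
  rewrite mulmx_diag; congr diag_mx; apply/rowP=> i.
  by rewrite mxE -vd expr2.
(* The hull lies in the code, of dimension [k]; once [k <= 1], the bound [r < k] leaves [k = 1] and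
   [r = 0]. *)
exists (const_mx 1) => [i|]; first by rewrite mxE oner_neq0.
rewrite diag_const_mx mulmx1.
apply: leq_trans (dimvS (capvSl _ _)) _; rewrite dim_gen_code //.
have q2 : (#|F| - 1 <= 1)%N by rewrite leq_subLR.
have : (0 < #|F| - 1)%N by rewrite subn_gt0 finNzRing_gt1.
move=> /dvdn_leq /(_ nq) /leq_trans /(_ q2); rewrite leq_subLR => n2.
have k1 : (k <= 1)%N by rewrite (leq_trans kn) // (leq_div2r 2 n2).
by case: k r k1 rk {kn fG G} => [|[|k]] [|r].
Qed.

Theorem corollary1 (q : nat) (F : finFieldType) (hF : #|F| = q)
    (hq : ~~ odd q) (n : nat) (hn : (0 < n)%N) (hnq : (n - 1 %| q - 1)%N)
    (k r : nat) (hk : (k <= n %/ 2)%N) (hr : (r < k)%N) :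
  ((exists2 eta : F, eta != 0 &
      forall a, a \in Ssums F n k -> eta^-1 <> - a) ->
   exists C : {vspace 'rV[F]_n},
     [/\ is_code k (n - k + 1) C, MDS C
       & (0 <= \dim (euclid_hull C) <= k - r)%N])
  /\
  ((exists2 eta : F, eta != 0 &
      exists2 a, a \in Ssums F n k & eta^-1 = - a) ->
   exists C : {vspace 'rV[F]_n},
     [/\ is_code k (n - k) C, AMDS C
       & (0 <= \dim (euclid_hull C) <= k - r)%N]).
Proof.
subst q; case: k => // k in hk hr *.
have kn : (k.+1 < n)%N.
  apply: leq_ltn_trans hk _; exact: ltn_Pdiv.
have cU : #|Uset F n| = n by apply: card_Uset => //; apply: leq_ltn_trans kn.
pose u (i : 'I_n) : F := enum_val (cast_ord (esym cU) i).
have u_inj : injective u by apply: inj_comp enum_val_inj (@cast_ord_inj _ _ _).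
have uU : u @: setT = Uset F n.
  apply/eqP; rewrite eqEcard card_imset // cardsT card_ord cU leqnn andbT.
  by apply/subsetP=> _ /imsetP[i _ ->]; apply: enum_valP.
(* Both halves reduce to the minimum weight of the unscaled code, since the scaling that shrinks the
   hull preserves weights. *)
have code eta d : (0 < d)%N ->
    (forall m, m != 0 -> (d <= weight (m *m trs_mx k eta u))%N) ->
    (exists2 m, m != 0 & weight (m *m trs_mx k eta u) = d) ->
    exists2 C : {vspace 'rV[F]_n}, is_code k.+1 d C
      & (0 <= \dim (euclid_hull C) <= k.+1 - r)%N.
  move=> d0 wd wm.
  have fG : row_free (trs_mx k eta u).
    by apply: weight_row_free => m /wd; apply: leq_trans.
  have [v v0 hull] := hull_scaling hq hnq hk hr fG.
  by exists (gen_code (trs_mx k eta u *m diag_mx v)); first exact: is_code_gen_diag.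
split=> [[eta eta0 etaS]|[eta eta0 [_ /imsetP[J JUk ->] etaE]]].
  have wd m : m != 0 -> (n - k.+1 + 1 <= weight (m *m trs_mx k eta u))%N.
    move=> m0; rewrite weight_trs addn1 -subSn ?(ltnW kn) // subSS leq_sub2l //.
    (* With [k.+1] zeros, [eta^-1] would be the opposite of a subset sum, which is excluded; hence
       at most [k] zeros. *)
    have := card_zeros eta u_inj m0; rewrite leq_eqVlt => /predU1P[cZ|//].
    case: (etaS _ _ (zeros_max_sum u_inj m0 cZ)).
    apply/imsetP; exists (u @: zeros eta u m) => //.
    by rewrite inE card_imset // cZ eqxx -uU imsetS ?subsetT.
  have [C codeC hullC] : exists2 C : {vspace 'rV[F]_n},
      is_code k.+1 (n - k.+1 + 1) C & (0 <= \dim (euclid_hull C) <= k.+1 - r)%N.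
    apply: (code eta) => //; first by rewrite addn1.
    have [m m0 wm] := singleton_bound (trs_mx k eta u) (ltnW (ltnW kn)).
    exists m => //; apply/eqP; rewrite eqn_leq wd // andbT.
    by rewrite addn1 -subSn ?(ltnW kn).
  by exists C; split=> //; rewrite /MDS; case: codeC => ->.
move: JUk; rewrite inE => /andP[JU /eqP cJ].
have [C codeC hullC] : exists2 C : {vspace 'rV[F]_n},
    is_code k.+1 (n - k.+1) C & (0 <= \dim (euclid_hull C) <= k.+1 - r)%N.
  apply: (code eta); first by rewrite subn_gt0.
    by move=> m m0; rewrite weight_trs leq_sub2l // card_zeros.
  (* The subset [J] yields a word with the maximal number [k.+1] of zeros, so the lower bound is
     attained. *)
  have [|m m0 cZ] := zeros_of_sum u_inj _ cJ eta0 etaE; first by rewrite uU.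
  by exists m; rewrite // weight_trs cZ.
by exists C; split=> //; rewrite /AMDS; case: codeC => ->.
Qed.
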